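(* Let $n\ge 1$ and let $f\in\mathcal{H}_{n,2}$ be a quadratic homogeneous polynomial with integer coefficients, with $\overline{f}>\underline{f}$. Then $\rho_r(f)=O(1/r^2)$ as $r\to\infty$; that is, there is a constant $C$ (which may depend on $f$ but not on $r$) such that $\rho_r(f)\le C/r^2$ for all sufficiently large integers $r$.
   Context: $\mathcal{H}_{n,d}$ is the set of homogeneous polynomials of degree $d$ in $n$ variables with real coefficients. $\Delta_n=\{x\in\mathbb{R}^n: x_i\ge 0 \text{ for all } i,\ \sum_{i=1}^n x_i=1\}$ is the standard simplex. For an integer $r\ge1$, $\Delta(n,r)=\{x\in\Delta_n: rx\in\mathbb{N}^n\}$ (with $0\in\mathbb{N}$). Set $\underline{f}=\min_{x\in\Delta_n}f(x)$, $\overline{f}=\max_{x\in\Delta_n}f(x)$, $f_{\Delta(n,r)}=\min_{x\in\Delta(n,r)}f(x)$, and $$\rho_r(f)=\frac{f_{\Delta(n,r)}-\underline{f}}{\overline{f}-\underline{f}}.$$ *)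

(* Defs.v *)
From mathcomp Require Import all_boot all_order all_algebra.
From mathcomp Require Import classical_sets reals mpoly.
(* mpoly must be imported before topology: in the other order the levels of
   their notations conflict. *)
From mathcomp Require Import topology normedtype derive realfun.

Set Implicit Arguments.
Unset Strict Implicit.
Unset Printing Implicit Defensive.

Import Order.TTheory GRing.Theory Num.Theory.
Import numFieldNormedType.Exports.
Local Open Scope classical_set_scope.
Local Open Scope ring_scope.

(* Points of R^n are functions 'I_n -> R, the argument type of meval. *)
Definition simplex (R : realType) (n : nat) : set ('I_n -> R) :=
  [set x | (forall i, 0 <= x i) /\ \sum_(i < n) x i = 1].

(* For r = 0 the second condition is void; only 0 < r is meaningful. *)
Definition grid (R : realType) (n r : nat) : set ('I_n -> R) :=
  [set x | simplex x /\ forall i, r%:R * x i \is a Num.nat].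
Arguments grid R n r : clear implicits.
Arguments simplex R n : clear implicits.

(* inf and sup are total real-valued functions; the lemmas fmin_attained,
   fmax_attained and fmin_grid_attained below show that for 0 < n and 0 < r
   they are attained, i.e. that these are the minima and the maximum. *)
Definition fmin (R : realType) (n : nat) (f : {mpoly R[n]}) : R :=
  inf [set f.@[x] | x in simplex R n].

Definition fmax (R : realType) (n : nat) (f : {mpoly R[n]}) : R :=
  sup [set f.@[x] | x in simplex R n].

Definition fmin_grid (R : realType) (n : nat) (f : {mpoly R[n]}) (r : nat) : R :=
  inf [set f.@[x] | x in grid R n r].

Definition rho (R : realType) (n : nat) (f : {mpoly R[n]}) (r : nat) : R :=
  (fmin_grid f r - fmin f) / (fmax f - fmin f).

Lemma inf_min (R : realType) (A : set R) (m : R) :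
  A m -> lbound A m -> inf A = m.
Proof.
move=> Am lbm; apply/eqP; rewrite eq_le; apply/andP; split.
  by apply: ge_inf => //; exists m.
by apply: lb_le_inf => //; exists m.
Qed.

Lemma sup_max (R : realType) (A : set R) (m : R) :
  A m -> ubound A m -> sup A = m.
Proof.
move=> Am ubm; apply/eqP; rewrite eq_le; apply/andP; split.
  by apply: ge_sup => //; exists m.
by apply: ub_le_sup => //; exists m.
Qed.

Lemma grid_nonempty (R : realType) (n r : nat) :
  (0 < n)%N -> grid R n r !=set0.
Proof.
case: n => // n _; exists (fun i => (i == ord0)%:R); split; first split.
- by move=> i; rewrite ler0n.
- by rewrite (bigD1 ord0) //= big1 ?addr0 // => i /negbTE ->.
- by move=> i; rewrite -natrM natr_nat.
Qed.

Lemma simplex_nonempty (R : realType) (n : nat) :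
  (0 < n)%N -> simplex R n !=set0.
Proof. by move=> /(grid_nonempty R 1)[x [sx _]]; exists x. Qed.

Section Attained.
Import ArrowAsProduct.

Lemma coord_fun_continuous (R : realType) (n : nat) (i : 'I_n) :
  continuous (fun x : 'I_n -> R => x i).
Proof. exact: (@proj_continuous 'I_n (fun=> R) i). Qed.

Lemma meval_continuous (R : realType) (n : nat) (f : {mpoly R[n]}) :
  continuous (fun x : 'I_n -> R => f.@[x]).
Proof.
have -> : (fun x : 'I_n -> R => f.@[x]) =
  (fun x => \sum_(m <- msupp f) f@_m * \prod_(i < n) x i ^+ m i).
  by apply: boolp.funext => x; rewrite mevalE.
apply: continuous_big => [|m _]; first exact: add_continuous.
have comp_cont (T U V : topologicalType) (g : T -> U) (h : U -> V) :
    continuous g -> continuous h -> continuous (h \o g).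
  by move=> cg ch x; apply: continuous_comp; [exact: cg | exact: ch].
apply: (comp_cont _ _ _ (fun y : 'I_n -> R => \prod_(i < n) y i ^+ m i)
  ( *%R f@_m)); last exact: mulrl_continuous.
apply: continuous_big => [|i _]; first exact: mul_continuous.
apply: (comp_cont _ _ _ (fun y : 'I_n -> R => y i) (fun t => t ^+ m i)).
  exact: coord_fun_continuous.
exact: exprn_continuous.
Qed.

Lemma simplex_compact (R : realType) (n : nat) : compact (simplex R n).
Proof.
have cube : compact [set x : 'I_n -> R | forall i, (`[0, 1]%classic : set R) (x i)].
  exact: (@tychonoff 'I_n (fun=> R) (fun=> `[0, 1]%classic)
    (fun=> @segment_compact R 0 1)).
have -> : simplex R n =
    [set x : 'I_n -> R | forall i, (`[0, 1]%classic : set R) (x i)] `&`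
    [set x | \sum_(i < n) x i = 1].
  apply/seteqP; split => x [x0 x1]; split => // i; last by have /andP[] := x0 i.
  rewrite /= in_itv /= x0 /= -x1 (bigD1 i) //= lerDl.
  by apply: sumr_ge0 => j _.
apply: compact_closedI => //.
apply: (@preimage_closed _ _ (fun x : 'I_n -> R => \sum_(i < n) x i)
  [set y | y = 1]); last exact: closed_eq.
move=> x _; move: x; apply: continuous_big => [|i _]; first exact: add_continuous.
exact: coord_fun_continuous.
Qed.

Lemma fmin_attained (R : realType) (n : nat) (f : {mpoly R[n]}) : (0 < n)%N ->
  exists2 x, simplex R n x &
    fmin f = f.@[x] /\ forall y, simplex R n y -> f.@[x] <= f.@[y].
Proof.
move=> n0; have [|c cs cmin] :=
    compact_EVT_min (simplex_nonempty R n0) (@simplex_compact R n)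
      (f := fun x : 'I_n -> R => f.@[x]).
  exact/continuous_subspaceT/meval_continuous.
have lec y : simplex R n y -> f.@[c] <= f.@[y] by move=> ys; exact/cmin/mem_set.
exists c; [exact: set_mem | split => //].
by apply: inf_min => [|_ [y ys <-]]; [exists c => //; exact: set_mem | exact: lec].
Qed.

Lemma fmax_attained (R : realType) (n : nat) (f : {mpoly R[n]}) : (0 < n)%N ->
  exists2 x, simplex R n x &
    fmax f = f.@[x] /\ forall y, simplex R n y -> f.@[y] <= f.@[x].
Proof.
move=> n0; have [|c cs cmax] :=
    compact_EVT_max (simplex_nonempty R n0) (@simplex_compact R n)
      (f := fun x : 'I_n -> R => f.@[x]).
  exact/continuous_subspaceT/meval_continuous.
have lec y : simplex R n y -> f.@[y] <= f.@[c] by move=> ys; exact/cmax/mem_set.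
exists c; [exact: set_mem | split => //].
by apply: sup_max => [|_ [y ys <-]]; [exists c => //; exact: set_mem | exact: lec].
Qed.

Lemma fmin_grid_attained (R : realType) (n r : nat) (f : {mpoly R[n]}) :
  (0 < n)%N -> (0 < r)%N ->
  exists2 x, grid R n r x &
    fmin_grid f r = f.@[x] /\ forall y, grid R n r y -> f.@[x] <= f.@[y].
Proof.
move=> n0 r0; have rR : r%:R != 0 :> R by rewrite pnatr_eq0 -lt0n.
pose pt (k : {ffun 'I_n -> 'I_r.+1}) : 'I_n -> R := fun i => (k i)%:R / r%:R.
have ptP y : grid R n r y -> exists k, y = pt k.
  move=> [[y0 y1] yr].
  have yi i : exists k : 'I_r.+1, y i == k%:R / r%:R.
    have /natrP[k ky] := yr i.
    have kr : (k < r.+1)%N.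
      rewrite ltnS -(ler_nat R) -ky ler_piMr // -y1 (bigD1 i) //= lerDl.
      by apply: sumr_ge0 => j _.
    by exists (Ordinal kr); rewrite /= -ky mulrAC divff // mul1r.
  exists [ffun i => xchoose (yi i)]; apply: boolp.funext => i.
  by rewrite /pt ffunE; apply/eqP; exact: (xchooseP (yi i)).
have [x0 gx0] := grid_nonempty R r n0.
have [k0 x0k0] := ptP _ gx0.
pose P k := boolp.asbool (grid R n r (pt k)).
have Pk0 : P k0.
  by apply/boolp.asboolP; rewrite -x0k0.
case: (Order.TotalTheory.arg_minP (P := P) (fun k => f.@[pt k]) Pk0) => k.
move=> /boolp.asboolP gk kmin.
have lek y : grid R n r y -> f.@[pt k] <= f.@[y].
  by move=> gy; have [j yj] := ptP _ gy; rewrite yj; apply: kmin;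
    apply/boolp.asboolP; rewrite -yj.
exists (pt k) => //; split => //.
by apply: inf_min => [|_ [y ys <-]]; [exists (pt k) | exact: lek].
Qed.

End Attained.

(* Main.v *)
Require Import Defs.
From mathcomp Require Import all_boot all_order all_algebra.
From mathcomp Require Import classical_sets reals mpoly.
From mathcomp Require Import ring lra.

Import Order.TTheory GRing.Theory Num.Theory.

(** Write [q(d)] for the value of the quadratic form [f] at a displacement [d].
    Let [x] minimize [f] on the simplex and let [y = x + d] be another point of
    the simplex.  If the reflected point [x - d] still lies in the simplex, then
    the parallelogram identity [f(x + d) + f(x - d) = 2 f(x) + 2 q(d)] together
    with [f(x - d) >= f(x)] gives [f(y) - f(x) <= 2 q(d)]
    (minimizer_second_order): the first-order term has disappeared, because
    [x] is also a minimum along the segment from [x - d] to [x + d].  As [q] is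
    quadratic, [q(d)] is at most a constant times the square of the largest
    [|d_i|] (meval_quadratic_le), so it suffices to find a grid point [y] at
    distance [O(1/r)] from [x] whose reflection is in the simplex.

    Such a [y] is obtained by rounding every coordinate of [x] down to a
    multiple of [1/r], except one coordinate [j] with [x_j > 0], which absorbs
    the lost mass, at most [n/r] (simplex_rounding).  Reflection increases the
    coordinates other than [j], and [x_j - d_j >= x_j - n/r] is nonnegative as
    soon as [r >= n / x_j]. *)

Local Open Scope ring_scope.

(** Quadratic monomials are products of two coordinates; this reduces identities
    and estimates on forms of degree 2 to computations with a product of two
    scalars. *)
Lemma mnm_deg2_prod (R : comNzRingType) (n : nat) (m : 'X_{1..n}) :
  mdeg m = 2%N ->
  exists i j : 'I_n, forall v : 'I_n -> R, \prod_(k < n) v k ^+ m k = v i * v j.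
Proof.
move=> m2; have [i mi] : exists i, (m i != 0)%N.
  by apply/existsP; apply: contraPT m2 => /existsPn m0;
    rewrite mdegE big1 // => i _; apply/eqP; rewrite -[_ == _]negbK m0.
have mK : (m - U_(i) + U_(i))%MM = m.
  apply: submK; apply/mnm_lepP => k; rewrite mnm1E.
  by case: eqP => // <-; rewrite lt0n.
have /mdeg1P[j /eqP mj] : mdeg (m - U_(i))%MM == 1%N.
  by move: m2; rewrite -{1}mK mdegD mdeg1 addn1 => -[->].
have mE : m = (U_(i) + U_(j))%MM by rewrite -[LHS]mK mj addmC.
exists i, j => v; rewrite mE.
under eq_bigr => k _ do rewrite mnmDE exprD !mnm1E.
rewrite big_split /= (bigD1 i) //= eqxx expr1 big1 ?mulr1; last first.
  by move=> k ki; rewrite eq_sym (negbTE ki) expr0.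
rewrite (bigD1 j) //= eqxx expr1 big1 ?mulr1 //.
by move=> k kj; rewrite eq_sym (negbTE kj) expr0.
Qed.

Lemma meval_parallelogram (R : comNzRingType) (n : nat) (f : {mpoly R[n]})
    (x d : 'I_n -> R) : f \is 2.-homog ->
  f.@[fun i => x i + d i] + f.@[fun i => x i - d i] = (f.@[x] + f.@[d]) *+ 2.
Proof.
move=> /dhomogP f2; rewrite !mevalE -!big_split -sumrMnl /=.
apply: eq_big_seq => m /f2 /(@mnm_deg2_prod R)[i [j mE]].
by rewrite !mE; ring.
Qed.

(** Each of the two factors of a quadratic monomial contributes one factor [e],
    which is where the order [1/r^2] of the final estimate comes from. *)
Lemma meval_quadratic_le (R : realDomainType) (n : nat) (f : {mpoly R[n]})
    (d : 'I_n -> R) (e : R) : f \is 2.-homog ->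
  (forall i, `|d i| <= e) ->
  f.@[d] <= (\sum_(m <- msupp f) `|f@_m|) * e ^+ 2.
Proof.
move=> /dhomogP f2 de; rewrite mevalE mulr_suml big_seq [leRHS]big_seq.
apply: ler_sum => m /f2 /(@mnm_deg2_prod R)[i [j mE]]; rewrite mE.
apply: le_trans (ler_norm _) _; rewrite !normrM expr2.
by apply: ler_wpM2l => //; apply: ler_pM.
Qed.

(** Rounding down all coordinates but the [j]-th keeps them nonnegative and moves
    mass to [j] only; the one-sided signs of [x i - y i] are what makes the
    reflection [2 x - y] stay in the simplex. *)
Lemma simplex_rounding (R : realType) (n r : nat) (x : 'I_n -> R) (j : 'I_n) :
  simplex R n x -> (0 < r)%N ->
  exists2 y, grid R n r y &
    (forall i, i != j -> 0 <= x i - y i <= r%:R^-1) /\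
    0 <= y j - x j <= n%:R / r%:R.
Proof.
move=> [x0 x1] r0; have rR : 0 < r%:R :> R by rewrite ltr0n.
have rN : r%:R != 0 :> R by rewrite gt_eqF.
pose k i := Num.truncn (r%:R * x i).
have kP i : (k i)%:R <= r%:R * x i < (k i)%:R + 1.
  by rewrite natr1; apply: truncn_itv; rewrite mulr_ge0.
have kr : (\sum_(i < n | i != j) k i <= r)%N.
  rewrite -(ler_nat R) natr_sum.
  have -> : r%:R = \sum_(i < n) r%:R * x i by rewrite -mulr_sumr x1 mulr1.
  rewrite [leRHS](bigD1 j) //=.
  apply: ler_wpDl; first by rewrite mulr_ge0.
  by apply: ler_sum => i _; have /andP[] := kP i.
pose K i := if i == j then (r - \sum_(i < n | i != j) k i)%N else k i.
pose y i : R := (K i)%:R / r%:R.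
have KP i : i != j -> 0 <= x i - y i <= r%:R^-1.
  move=> /negbTE ij; rewrite /y /K ij; have /andP[kx /ltW xk] := kP i.
  rewrite subr_ge0 ler_pdivrMr // mulrC kx /= lerBlDr.
  by rewrite -[X in _ <= X + _]mul1r -mulrDl ler_pdivlMr // mulrC addrC.
have y1 : \sum_(i < n) y i = 1.
  rewrite /y -mulr_suml -natr_sum (bigD1 j) //= {1}/K eqxx.
  rewrite (eq_bigr k) => [|i /negbTE ij]; last by rewrite /K ij.
  by rewrite subnK // divff.
exists y; first split; first split => // i.
- by rewrite divr_ge0.
- by move=> i; rewrite /y mulrC divfK // natr_nat.
split => //.
(* Both points have total mass 1, so [j] gains what the others lose. *)
have -> : y j - x j = \sum_(i < n | i != j) (x i - y i).
  rewrite sumrB; move: x1 y1; rewrite (bigD1 j) //= (bigD1 j (F := y)) //=.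
  by move=> xs ys; lra.
apply/andP; split; first by apply: sumr_ge0 => i /KP/andP[].
apply: (@le_trans _ _ (\sum_(i < n) r%:R^-1)); last first.
  by rewrite sumr_const card_ord mulr_natl.
rewrite [leRHS](bigD1 j) //=; apply: ler_wpDl; first by rewrite invr_ge0.
by apply: ler_sum => i /KP/andP[].
Qed.

(** Feasibility of the reflected point [x - d] replaces the first-order
    optimality conditions: it makes the linear term of [f] in direction [d]
    bounded by the quadratic one. *)
Lemma minimizer_second_order (R : realType) (n : nat) (f : {mpoly R[n]})
    (x d : 'I_n -> R) : f \is 2.-homog ->
  (forall y, simplex R n y -> f.@[x] <= f.@[y]) ->
  simplex R n (fun i => x i - d i) ->
  f.@[fun i => x i + d i] <= f.@[x] + f.@[d] *+ 2.
Proof.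
move=> f2 xmin /xmin fle; have := meval_parallelogram _ _ _ x d f2.
by rewrite mulrnDl !mulr2n; lra.
Qed.

Theorem corollary2p1 (R : realType) (n : nat) (f : {mpoly R[n]}) :
  (1 <= n)%N ->
  f \is 2.-homog ->
  f \is a mpolyOver n Num.int ->
  fmin f < fmax f ->
  exists (C : R) (r0 : nat), forall r : nat,
    (1 <= r)%N -> (r0 <= r)%N -> rho f r <= C / r%:R ^+ 2.
Proof.
move=> n0 f2 _ fmm; have [x sx [fx xmin]] := fmin_attained f n0.
have [x0 x1] := sx.
have [j xj] : exists j, 0 < x j.
  apply/existsP; apply: contraT => /existsPn xn; have := oner_neq0 R.
  rewrite -x1 big1 ?eqxx // => i _; apply/eqP.
  by rewrite eq_le x0 andbT leNgt xn.
(* The threshold on [r] is [n / x j], from which on [x j] exceeds [n / r]. *)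
pose M := \sum_(m <- msupp f) `|f@_m|.
exists (M * n%:R ^+ 2 *+ 2 / (fmax f - fmin f)), (Num.truncn (n%:R / x j)).+1.
move=> r r1 rbig; have rR : 0 < r%:R :> R by rewrite ltr0n.
have nr : n%:R / r%:R <= x j.
  rewrite ler_pdivrMr // mulrC -ler_pdivrMr //.
  apply: (le_trans (ltW (truncnS_gt _))); by rewrite ler_nat.
have [y gy [yi yj]] := simplex_rounding _ _ _ _ j sx r1.
have [[y0 y1] _] := gy.
have [z _ [fz zmin]] := fmin_grid_attained f n0 r1.
have dP i : `|y i - x i| <= n%:R / r%:R.
  have [->|ij] := eqVneq i j; first by case/andP: yj => ? ?; rewrite ger0_norm.
  have /andP[d0 d1] := yi i ij; rewrite distrC ger0_norm //.
  apply: le_trans d1 _; rewrite -[leLHS]mul1r ler_wpM2r ?invr_ge0 //.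
  by rewrite ler1n.
have sxd : simplex R n (fun i => x i - (y i - x i)).
  split=> [i|]; last by rewrite !sumrB x1 y1; lra.
  have [->|ij] := eqVneq i j; first by case/andP: yj => ? ?; lra.
  by have /andP[d0 d1] := yi i ij; have := x0 i; lra.
have gap : fmin_grid f r - fmin f <= M * (n%:R / r%:R) ^+ 2 *+ 2.
  have := minimizer_second_order _ _ _ _ _ f2 xmin sxd.
  have -> : f.@[fun i => x i + (y i - x i)] = f.@[y].
    by apply: meval_eq => i; rewrite addrC subrK.
  have := meval_quadratic_le _ _ _ _ _ f2 dP; have := zmin y gy.
  by rewrite -/M fz fx !mulr2n; lra.
have gap0 : 0 < fmax f - fmin f by rewrite subr_gt0.
rewrite /rho ler_pdivrMr //; apply: le_trans gap _.
rewrite le_eqVlt; apply/orP; left; apply/eqP.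
by field; rewrite !gt_eqF.
Qed.
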